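(* Suppose $(C(SU(2)),L_2(SU(2)),D)$ is an equivariant spectral triple, and assume that $D$ has nontrivial sign. Then $D$ cannot be $p$-summable for $p<4$ ($p>0$).
   Context: $L_2(SU(2))$ has an orthonormal basis $\{e^{(n)}_{ij}: n=0,\frac12,1,\ldots;\ i,j=-n,-n+1,\ldots,n\}$ (normalized matrix entries of the irreducible representations). $C(SU(2))$ is generated by the two coordinate functions $\alpha,\beta$, which act on $L_2(SU(2))$ by $$\alpha e^{(n)}_{ij}=a_+(n,i,j)e^{(n+1/2)}_{i-1/2,j-1/2}+a_-(n,i,j)e^{(n-1/2)}_{i-1/2,j-1/2},\quad \beta e^{(n)}_{ij}=b_+(n,i,j)e^{(n+1/2)}_{i+1/2,j-1/2}+b_-(n,i,j)e^{(n-1/2)}_{i+1/2,j-1/2},$$ $$a_+=\Bigl(\tfrac{(n-j+1)(n-i+1)}{(2n+1)(2n+2)}\Bigr)^{1/2},\ a_-=\Bigl(\tfrac{(n+j)(n+i)}{2n(2n+1)}\Bigr)^{1/2},\ b_+=-\Bigl(\tfrac{(n-j+1)(n+i+1)}{(2n+1)(2n+2)}\Bigr)^{1/2},\ b_-=\Bigl(\tfrac{(n+j)(n-i)}{2n(2n+1)}\Bigr)^{1/2},$$ where terms involving basis vectors with indices out of range are zero. $(C(SU(2)),L_2(SU(2)),D)$ is a spectral triple if $D$ is self-adjoint with compact resolvent and $[D,a]$ is bounded for all $a$ in the $*$-algebra generated by $\alpha,\beta$. It is equivariant if $D$ is, where equivariance means commuting with the (regular) representation of $\mathfrak{su}(2)$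 on $L_2(SU(2))$ acting on the index $j$; by standing convention the equivariant self-adjoint operators with discrete spectrum under consideration are those of the form $D:e^{(n)}_{ij}\mapsto d(n,i)e^{(n)}_{ij}$ with $d(n,i)$ real. $\mathrm{sign}\,D$ is called trivial if it is $I$ or $-I$ up to a compact perturbation, and nontrivial otherwise. $D$ is $p$-summable if $|D|^{-p}$ (inverse taken on the orthogonal complement of the kernel) lies in $\mathcal{L}^{(1,\infty)}$, the ideal of compact operators whose singular values $\mu_1\ge\mu_2\ge\cdots$ satisfy $\sum_{k=1}^N\mu_k=O(\log N)$. *)

(* Defs.v *)
From HB Require Import structures.
From mathcomp Require Import all_boot all_order all_algebra.
From mathcomp Require Import sesquilinear complex.
From mathcomp Require Import all_classical all_reals all_analysis.

Set Implicit Arguments.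
Unset Strict Implicit.
Unset Printing Implicit Defensive.

Import Order.TTheory GRing.Theory Num.Theory.
Import numFieldNormedType.Exports.

Local Open Scope classical_set_scope.
Local Open Scope ring_scope.
Local Open Scope complex_scope.

Section HilbertSpace.
Variables (R : realType) (H : lmodType R[i]).
Variable ip : {dot H for (@Num.conj R[i])}.

Definition hnorm (x : H) : R := Num.sqrt (complex.Re (ip x x)).

Definition hconverges (u : nat -> H) (l : H) : Prop :=
  hnorm (u n - l) @[n --> \oo] --> (0 : R).

(* [ip] is positive definite as a [{dot _ for _}], so only completeness is
   missing for [H] to be a Hilbert space. *)
Definition hilbert : Prop :=
  forall u : nat -> H,
    (forall eps : R, 0 < eps ->
      exists N, forall m n, (N <= m)%N -> (N <= n)%N ->
        hnorm (u m - u n) < eps) ->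
    exists l, hconverges u l.

Definition bounded_op (T : H -> H) : Prop :=
  linear T /\ exists c : R, forall x, hnorm (T x) <= c * hnorm x.

Definition compact_op (T : H -> H) : Prop :=
  bounded_op T /\
  forall u : nat -> H, (exists c : R, forall n, hnorm (u n) <= c) ->
    exists phi : nat -> nat,
      {homo phi : m n / (m < n)%N} /\ exists l, hconverges (T \o u \o phi) l.

Definition is_adjoint (T T' : H -> H) : Prop :=
  bounded_op T' /\ forall x y, ip (T x) y = ip x (T' y).

Inductive star_algebra (A B : H -> H) : (H -> H) -> Prop :=
| star_genl : star_algebra A B A
| star_genr : star_algebra A B B
| star_add S T : star_algebra A B S -> star_algebra A B T ->
    star_algebra A B (fun x => S x + T x)
| star_scale (c : R[i]) T : star_algebra A B T ->
    star_algebra A B (fun x => c *: T x)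
| star_mul S T : star_algebra A B S -> star_algebra A B T ->
    star_algebra A B (S \o T)
| star_adj T T' : star_algebra A B T -> is_adjoint T T' ->
    star_algebra A B T'.

(* An unbounded operator is given by its graph: [D x y] means that [x] lies in
   the domain of [D] and [D x = y]. *)
Definition unbounded_op := H -> H -> Prop.

Definition domain (D : unbounded_op) : set H := [set x | exists y, D x y].

Definition densely_defined (D : unbounded_op) : Prop :=
  forall (x : H) (eps : R), 0 < eps ->
    exists2 z, domain D z & hnorm (x - z) < eps.

Definition adjoint_graph (D : unbounded_op) : unbounded_op :=
  fun x y => forall u v, D u v -> ip v x = ip u y.

Definition self_adjoint (D : unbounded_op) : Prop :=
  densely_defined D /\ forall x y, D x y <-> adjoint_graph D x y.

(* [K = (D - l)^-1] for some [l] in the resolvent set; by the resolvent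
   identity, compactness does not depend on [l]. *)
Definition compact_resolvent (D : unbounded_op) : Prop :=
  exists (l : R[i]) (K : H -> H), compact_op K /\
    forall x y, K y = x <-> exists2 z, D x z & z - l *: x = y.

Definition bounded_commutator (D : unbounded_op) (T : H -> H) : Prop :=
  (forall x, domain D x -> domain D (T x)) /\
  exists c : R, forall x y z, D x y -> D (T x) z ->
    hnorm (z - T y) <= c * hnorm x.

(* [T = phi(D)] for a self-adjoint [D] with compact resolvent: such a [D] has an
   orthonormal basis of eigenvectors, so a bounded [phi(D)] is determined by its
   action on eigenvectors. *)
Definition is_function_of (phi : R -> R) (D : unbounded_op) (T : H -> H) :
    Prop :=
  bounded_op T /\
  forall (l : R) (x : H), D x (l%:C *: x) -> T x = (phi l)%:C *: x.

(* The convention [sign 0 = 0] is immaterial: [ker D] is finite dimensional. *)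
Definition trivial_sign (D : unbounded_op) : Prop :=
  exists S, is_function_of Num.sg D S /\
    (compact_op (fun x => S x - x) \/ compact_op (fun x => S x + x)).

Definition has_dim (E : set H) (m : nat) : Prop :=
  exists v : 'I_m -> H,
    [/\ forall k, E (v k),
        forall c : 'I_m -> R[i], \sum_k c k *: v k = 0 -> forall k, c k = 0
      & forall x, E x -> exists c : 'I_m -> R[i], x = \sum_k c k *: v k].

(* [mu 0 >= mu 1 >= ...] lists the eigenvalues of [|T| = (T^* T)^(1/2)] with
   multiplicity, and is 0 from some point on if [T] has finite rank: every
   [s > 0] occurs [dim (ker (T^* T - s^2))] times. *)
Definition singular_values (T : H -> H) (mu : nat -> R) : Prop :=
  [/\ forall k, 0 <= mu k, nonincreasing_seq mu
    & exists2 T', is_adjoint T T' &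
        forall s : R, 0 < s ->
          exists2 m, has_dim [set x | T' (T x) = (s ^+ 2)%:C *: x] m
            & ([set k | mu k = s] #= `I_m)%card].

Definition in_L1inf (T : H -> H) : Prop :=
  compact_op T /\ exists2 mu, singular_values T mu &
    (fun N : nat => \sum_(k < N) mu k : R^o) =O_\oo (fun N => ln N%:R : R^o).

Definition p_summable (p : R) (D : unbounded_op) : Prop :=
  exists2 T, is_function_of
    (fun l => if l == 0 then 0 else `|l| `^ (- p)) D T & in_L1inf T.

End HilbertSpace.

Section SU2.
Variables (R : realType) (H : lmodType R[i]).
Variable ip : {dot H for (@Num.conj R[i])}.

Definition in_range (n i j : R) : bool :=
  [&& 2 * n \is a Num.nat, n + i \is a Num.nat, n - i \is a Num.nat,
      n + j \is a Num.nat & n - j \is a Num.nat].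

(* [e n i j] is the vector $e^{(n)}_{ij}$, with half-integers seen as real
   numbers; it is set to 0 outside the index range, as in the formulas for
   [alpha] and [beta]. *)
Definition orthonormal_basis (e : R -> R -> R -> H) : Prop :=
  [/\ forall n i j n' i' j', in_range n i j -> in_range n' i' j' ->
        ip (e n i j) (e n' i' j') = ((n, i, j) == (n', i', j'))%:R,
      forall n i j, ~~ in_range n i j -> e n i j = 0
    & forall x, (forall n i j, in_range n i j -> ip x (e n i j) = 0) -> x = 0].

Definition a_plus (n i j : R) : R :=
  Num.sqrt ((n - j + 1) * (n - i + 1) / ((2 * n + 1) * (2 * n + 2))).
Definition a_minus (n i j : R) : R :=
  Num.sqrt ((n + j) * (n + i) / (2 * n * (2 * n + 1))).
Definition b_plus (n i j : R) : R :=
  - Num.sqrt ((n - j + 1) * (n + i + 1) / ((2 * n + 1) * (2 * n + 2))).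
Definition b_minus (n i j : R) : R :=
  Num.sqrt ((n + j) * (n - i) / (2 * n * (2 * n + 1))).

Definition is_alpha (e : R -> R -> R -> H) (alpha : H -> H) : Prop :=
  bounded_op ip alpha /\
  forall n i j, in_range n i j ->
    alpha (e n i j) =
      (a_plus n i j)%:C *: e (n + 1 / 2) (i - 1 / 2) (j - 1 / 2)
      + (a_minus n i j)%:C *: e (n - 1 / 2) (i - 1 / 2) (j - 1 / 2).

Definition is_beta (e : R -> R -> R -> H) (beta : H -> H) : Prop :=
  bounded_op ip beta /\
  forall n i j, in_range n i j ->
    beta (e n i j) =
      (b_plus n i j)%:C *: e (n + 1 / 2) (i + 1 / 2) (j - 1 / 2)
      + (b_minus n i j)%:C *: e (n - 1 / 2) (i + 1 / 2) (j - 1 / 2).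

(* Together with self-adjointness this determines [D] with its domain. *)
Definition equivariant (e : R -> R -> R -> H) (D : unbounded_op H) : Prop :=
  exists d : R -> R -> R, forall n i j, in_range n i j ->
    D (e n i j) ((d n i)%:C *: e n i j).

Definition spectral_triple (alpha beta : H -> H) (D : unbounded_op H) : Prop :=
  [/\ self_adjoint ip D, compact_resolvent ip D
    & forall a, star_algebra ip alpha beta a -> bounded_commutator ip D a].

End SU2.

(* Main.v *)
Require Import Defs.
From mathcomp Require Import all_boot all_order all_algebra.
From mathcomp Require Import sesquilinear complex.
From mathcomp Require Import all_classical all_reals all_analysis.
From mathcomp Require Import ring lra zify.

(** Index the basis by natural numbers: with [a = n - i] and [b = n + i] the
    eigenvalues of [D] form a function [f a b] on the quarter plane, and [f a b]
    has multiplicity [2 n + 1 = a + b + 1], the number of values of [j].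

    Evaluating the commutators with [alpha] and [beta] on the vectors with
    [j = - n] bounds the increments of [f] ([eigenvalue_slow]):
      [|f (a+1) b - f a b| <= C sqrt ((a+b+2) / (a+1))]  and
      [|f a (b+1) - f a b| <= C sqrt ((a+b+2) / (b+1))].
    Compactness of the resolvent says that [|f|] tends to infinity
    ([eigenvalue_coercive]), and nontriviality of the sign that [f] takes either
    sign infinitely often, as otherwise [sign D] would differ from [I] or [- I]
    by a finite rank operator ([eventual_sign_trivial]).

    Such an [f] is small along a whole row or column ([sign_change_small_row]).
    Indeed the steps in the direction of [b] are bounded by [2 C] as soon as
    [a <= b + 1], and since [|f| > 2 C] far away, such a step does not change
    the sign of [f].  So every row has an eventual sign, every column has one by
    symmetry, and the sign is eventually constant along the diagonal; all rows
    and columns far away share the sign of the diagonal.  A remaining row of the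
    other sign forces two adjacent rows [a], [a+1] of opposite eventual signs,
    whence
      [|f a b| <= |f (a+1) b - f a b| <= C sqrt (a+b+2)],
    that is [f a b = O (sqrt b)].  If there is none among the rows and columns,
    the sign of [f] is eventually constant.

    On that row, [b] in [[M, 2 M)] and [M] values of [j] give [M ^ 2]
    orthonormal eigenvectors of [|D| ^ (- p)] with eigenvalue at least of order
    [M ^ (- p / 2)].  So the sum of the first [M ^ 2] singular values is at
    least of order [M ^ (2 - p / 2)], a positive power of [M] when [p < 4], and
    not [O (ln M)] ([small_line_not_summable]). *)

Set Implicit Arguments.
Unset Strict Implicit.
Unset Printing Implicit Defensive.

Import Order.TTheory GRing.Theory Num.Theory.
Import numFieldNormedType.Exports.

Local Open Scope classical_set_scope.
Local Open Scope ring_scope.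
Local Open Scope complex_scope.

(** * Norm and compactness in an inner product space *)

Section InnerProduct.
Variables (R : realType) (H : lmodType R[i]).
Variable ip : {dot H for (@Num.conj R[i])}.

Local Notation N := (hnorm ip).

Lemma ipDl x y z : ip (x + y) z = ip x z + ip y z.
Proof. exact: linearDl. Qed.

Lemma ipBl x y z : ip (x - y) z = ip x z - ip y z.
Proof. exact: linearBl. Qed.

Lemma ipZl c x y : ip (c *: x) y = c * ip x y.
Proof. exact: linearZl_LR. Qed.

Lemma ipC x y : ip x y = Num.conj (ip y x).
Proof. by rewrite hermC /= mul1r. Qed.

Lemma conj_real (r : R) : Num.conj (r%:C : R[i]) = r%:C.
Proof. by apply/CrealP/complex_realP; exists r. Qed.

Lemma realC_sqr (r : R) : r%:C ^+ 2 = (r ^+ 2)%:C :> R[i].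
Proof. exact: esym (rmorphXn _ _ _). Qed.

Lemma linear_scale (T : H -> H) c x : linear T -> T (c *: x) = c *: T x.
Proof.
move=> linT; have T0 : T 0 = 0.
  by have := linT (-1) 0 0; rewrite scaler0 addr0 scaleN1r addNr.
by have := linT c x 0; rewrite T0 !addr0.
Qed.

Lemma hnorm_ge0 x : 0 <= N x.
Proof. exact: sqrtr_ge0. Qed.

Lemma ip_hnorm x : ip x x = (N x ^+ 2)%:C.
Proof.
have ge0 : 0 <= ip x x by exact: dnorm_ge0.
rewrite /hnorm sqr_sqrtr; last by move: ge0; rewrite lecE => /andP[].
by rewrite RRe_real // ger0_real.
Qed.

Lemma hnorm_eq1 x : ip x x = 1 -> N x = 1.
Proof. by rewrite /hnorm => ->; rewrite /= sqrtr1. Qed.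

Lemma norm_real_ex (c : R[i]) : exists2 r : R, 0 <= r & `|c| = r%:C.
Proof. by rewrite normc_def; eexists; last reflexivity; exact: sqrtr_ge0. Qed.

Lemma hnormZ c x r : `|c| = r%:C -> N (c *: x) = r * N x.
Proof.
move=> cr; have r0 : 0 <= r by rewrite -ler0c -cr normr_ge0.
have rN0 : 0 <= r * N x by apply: mulr_ge0 => //; exact: hnorm_ge0.
apply/eqP; rewrite -(eqrXn2 (ltn0Sn 1) (hnorm_ge0 _) rN0).
apply/eqP/complexI; rewrite -ip_hnorm dnormZ cr ip_hnorm exprMn.
by rewrite realC_sqr -[in LHS]rmorphM.
Qed.

Lemma hnorm_opp x : N (- x) = N x.
Proof. by rewrite -scaleN1r (@hnormZ _ _ 1) ?mul1r // normrN1. Qed.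

(** Half of the parallelogram law; it does the work of the triangle inequality
    where only convergence and boundedness matter. *)
Lemma parallelogram_le x y : N (x + y) ^+ 2 <= 2 * (N x ^+ 2 + N y ^+ 2).
Proof.
have par : N (x + y) ^+ 2 + N (x - y) ^+ 2 = 2 * (N x ^+ 2 + N y ^+ 2).
  have C2 (u v : R) : (2 * (u + v))%:C = 2 * (u%:C + v%:C) :> R[i].
    by rewrite rmorphM (rmorphD _ u v) (rmorph_nat _ 2).
  apply: complexI; rewrite rmorphD C2 /= -!ip_hnorm dnormD dnormB; ring.
by rewrite -par lerDl sqr_ge0.
Qed.

Lemma hnormD_le x y : N (x + y) <= 2 * (N x + N y).
Proof.
rewrite -(@ler_pXn2r _ 2) ?nnegrE ?mulr_ge0 ?addr_ge0 ?hnorm_ge0 //.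
apply: le_trans (parallelogram_le x y) _.
have := hnorm_ge0 x; have := hnorm_ge0 y; nra.
Qed.

(** Bessel's inequality for one vector. *)
Lemma norm_ip_le x u : N u = 1 -> `|ip x u| <= (N x)%:C.
Proof.
move=> u1; have uu : ip u u = 1 by rewrite ip_hnorm u1 expr1n.
pose r := x - ip x u *: u.
have ru : ip (ip x u *: u) r = 0.
  by rewrite ipZl [ip u r]ipC ipBl ipZl uu mulr1 subrr conjC0 mulr0.
have xE : x = ip x u *: u + r by rewrite /r addrC subrK.
rewrite -(@ler_pXn2r _ 2) ?nnegrE ?normr_ge0 ?ler0c ?hnorm_ge0 //.
rewrite [leRHS]realC_sqr -ip_hnorm.
rewrite [in leRHS]xE dnormD ru conjC0 !addr0 dnormZ uu mulr1 lerDl.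
exact: dnorm_ge0.
Qed.

Lemma bounded_opD S T : bounded_op ip S -> bounded_op ip T ->
  bounded_op ip (fun x => S x + T x).
Proof.
move=> [linS [c Sc]] [linT [d Td]]; split.
  by move=> a x y; rewrite linS linT scalerDr addrACA.
exists (2 * (c + d)) => x; apply: le_trans (hnormD_le _ _) _.
by rewrite -mulrA ler_pM2l // mulrDl lerD.
Qed.

Lemma extraction_cvgn (phi : nat -> nat) :
  {homo phi : m n / (m < n)%N} -> phi @ \oo --> \oo.
Proof.
move=> phi_mono.
have phi_ge n : (n <= phi n)%N.
  by elim: n => // n IHn; exact: leq_ltn_trans IHn (phi_mono _ _ _).
by move=> A [M _ MA]; exists M => // n Mn; exact: MA (leq_trans Mn (phi_ge n)).
Qed.

Lemma compact_opD S T : compact_op ip S -> compact_op ip T ->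
  compact_op ip (fun x => S x + T x).
Proof.
move=> [bS cS] [bT cT]; split; first exact: bounded_opD.
move=> u u_bd; have [phi [phi_mono [l ul]]] := cS u u_bd.
have [|psi [psi_mono [l' ul']]] := cT (u \o phi).
  by case: u_bd => c uc; exists c => n; exact: uc.
exists (phi \o psi); split; first by move=> m n mn; exact/phi_mono/psi_mono.
exists (l + l'); rewrite /hconverges in ul ul' *.
have {}ul := cvg_comp _ _ (extraction_cvgn psi_mono) ul.
have lim0 : 2 * (hnorm ip (S (u (phi (psi n))) - l) +
    hnorm ip (T (u (phi (psi n))) - l')) @[n --> \oo] --> (0 : R).
  rewrite -[X in _ --> X](mulr0 2) -[X in _ * X]addr0.
  exact: cvgM (cvg_cst _) (cvgD ul ul').
apply: squeeze_cvgr (cvg_cst 0) lim0; apply: nearW => n /=.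
rewrite hnorm_ge0 /=; apply: le_trans (hnormD_le _ _).
by rewrite opprD addrACA.
Qed.

(** Bolzano-Weierstrass applied twice, to the real and to the imaginary part of
    the coefficient along [v]. *)
Lemma compact_op_rank1 c v : N v = 1 ->
  compact_op ip (fun x => (c * ip x v) *: v).
Proof.
move=> v1; split.
  split.
    move=> a x y; rewrite ipDl ipZl scalerA -scalerDl; congr (_ *: _); ring.
  have [r r0 cr] := norm_real_ex c.
  exists r => x; have [s _ xs] := norm_real_ex (ip x v).
  rewrite (@hnormZ _ _ (r * s)) ?normrM ?cr ?xs ?rmorphM // v1 mulr1.
  apply: ler_wpM2l => //.
  by rewrite -lecR -xs norm_ip_le.
move=> u [B uB].
have bw (g : nat -> R) : (forall n, `|g n| <= B) ->
    exists2 f : nat -> nat, {homo f : m n / (m < n)%N} &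
      exists l : R, g (f n) @[n --> \oo] --> l.
  move=> gB; have [|f finc /cvg_ex[l fl]] := @bolzano_weierstrass R g.
    exists B; split; first exact: num_real.
    by move=> x Bx n _ /=; exact: le_trans (gB n) (ltW Bx).
  exists f; last by exists l.
  by move=> m n; have := finc n m; rewrite !leEnat !ltnNge => ->.
pose z n : R[i] := ip (u n) v.
have zB n : `|z n| <= B%:C.
  by apply: le_trans (norm_ip_le _ v1) _; rewrite lecR.
have zB' n : Num.sqrt ((complex.Re (z n)) ^+ 2 + (complex.Im (z n)) ^+ 2) <= B.
  by have := zB n; rewrite normc_def lecR.
have ReB n : `|complex.Re (z n)| <= B.
  by apply: le_trans (zB' n); rewrite -sqrtr_sqr ler_wsqrtr // lerDl sqr_ge0.
have [f f_inc [a fa]] := bw (fun n => complex.Re (z n)) ReB.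
have ImB n : `|complex.Im (z (f n))| <= B.
  apply: le_trans (zB' (f n)).
  by rewrite -sqrtr_sqr ler_wsqrtr // lerDr sqr_ge0.
have [g g_inc [b gb]] := bw (fun n => complex.Im (z (f n))) ImB.
exists (f \o g); split; first by move=> m n mn; exact/f_inc/g_inc.
exists ((c * (a +i* b)) *: v); rewrite /hconverges /=.
have fga : complex.Re (z (f (g n))) @[n --> \oo] --> a.
  exact: cvg_comp _ _ (extraction_cvgn g_inc) fa.
have [r r0 cr] := norm_real_ex c.
pose w n : R := (complex.Re (z (f (g n))) - a) ^+ 2 +
  (complex.Im (z (f (g n))) - b) ^+ 2.
have E n : hnorm ip ((c * z (f (g n))) *: v - (c * (a +i* b)) *: v) =
    r * Num.sqrt (w n).
  rewrite -scalerBl -mulrBr (@hnormZ _ _ (r * Num.sqrt (w n))) ?v1 ?mulr1 //.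
  rewrite normrM cr rmorphM normc_def /= /w.
  by case: (z _).
have w0 : w n @[n --> \oo] --> (0 : R).
  have h1 : complex.Re (z (f (g n))) - a @[n --> \oo] --> (0 : R).
    by rewrite -(subrr a); exact: cvgB fga (cvg_cst a).
  have h2 : complex.Im (z (f (g n))) - b @[n --> \oo] --> (0 : R).
    by rewrite -(subrr b); exact: cvgB gb (cvg_cst b).
  by rewrite -(addr0 0) -[X in X + _](mulr0 0) -[X in _ + X](mulr0 0);
    exact: cvgD (cvgM h1 h1) (cvgM h2 h2).
suff L : r * Num.sqrt (w n) @[n --> \oo] --> r * Num.sqrt 0.
  have r0E : r * Num.sqrt 0 = 0 by rewrite sqrtr0 mulr0.
  rewrite r0E in L.
  by apply: cvg_trans L; apply: near_eq_cvg; apply: nearW => n; rewrite -E.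
apply: cvgM; first exact: cvg_cst.
exact: continuous_cvg (@sqrt_continuous R 0) w0.
Qed.

Lemma compact_op0 : compact_op ip (fun=> 0).
Proof.
have N0 : hnorm ip 0 = 0 by rewrite /hnorm linear0r /= sqrtr0.
split; first split.
- by move=> a x y; rewrite scaler0 addr0.
- by exists 0 => x; rewrite N0 mul0r.
move=> u _; exists id; split=> //; exists 0; rewrite /hconverges /=.
rewrite (_ : (fun _ => _) = fun=> 0); first exact: cvg_cst.
by apply/funext => n; rewrite subr0.
Qed.

Lemma compact_op_finite_rank (I : eqType) (c : I -> R[i]) (v : I -> H)
    (s : seq I) : (forall t, N (v t) = 1) ->
  compact_op ip (fun x => \sum_(t <- s) (c t * ip x (v t)) *: v t).
Proof.
move=> v1; elim: s => [|t s IHs].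
  by under eq_fun do rewrite big_nil; exact: compact_op0.
under eq_fun do rewrite big_cons.
exact: compact_opD (compact_op_rank1 _ _) IHs.
Qed.

End InnerProduct.

(** * Counting *)

(** An element of a fibre of [f] is sent to the element of the corresponding
    fibre of [g] with the same rank; this is injective. *)
Lemma leq_card_fibres (V : eqType) (T K : finType) (f : T -> V) (g : K -> V) :
  (forall x, #|[pred y | f y == f x]| <= #|[pred k | g k == f x]|)%N ->
  (#|T| <= #|K|)%N.
Proof.
move=> fg; pose A x := enum [pred y | f y == f x].
pose B x := enum [pred k | g k == f x].
have Ax x : x \in A x by rewrite mem_enum inE.
have lt x : (index x (A x) < size (B x))%N.
  by rewrite /B -cardE; apply: leq_trans (fg x); rewrite cardE index_mem.
have k0 (x : T) : K by have := lt x; case: (B x).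
pose h x := nth (k0 x) (B x) (index x (A x)).
have gh x : g (h x) = f x.
  by have := mem_nth (k0 x) (lt x); rewrite mem_enum inE => /eqP.
apply: (@leq_card _ _ h) => x y hxy.
have fxy : f x = f y by rewrite -!gh hxy.
have AE : A x = A y by rewrite /A fxy.
have BE : B x = B y by rewrite /B fxy.
have : index x (A y) = index y (A y).
  apply/eqP; rewrite -(nth_uniq (k0 y) _ _ (enum_uniq [pred k | g k == f y])).
  - rewrite -/(B y) -[X in _ == X]/(h y) -hxy /h AE BE.
    by rewrite (set_nth_default (k0 x)) // -BE -AE lt.
  - by rewrite -/(B y) -BE -AE lt.
  - exact: lt.
by move/(congr1 (nth x (A y))); rewrite !nth_index // -AE.
Qed.

(** * Diagonal operators with respect to an orthonormal basis *)

Section Diagonal.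
Variables (R : realType) (H : lmodType R[i]).
Variable ip : {dot H for (@Num.conj R[i])}.

(** A linear relation between the coordinate vectors of the [u x] is one between
    the [u x] themselves, so these coordinate vectors are independent. *)
Lemma orthonormal_card_le_dim (E : set H) m (T : finType) (u : T -> H) :
  has_dim E m -> (forall x, E (u x)) ->
  (forall x y, ip (u x) (u y) = (x == y)%:R) -> (#|T| <= m)%N.
Proof.
move=> [v [_ _ gen]] Eu u_orth.
have [c uE] := choice (fun x => gen _ (Eu x)).
pose A := \matrix_(i < #|T|, k < m) c (enum_val i) k.
suff /eqP <- : row_free A by exact: rank_leq_col.
apply: inj_row_free => w wA.
have comb : \sum_i w 0 i *: u (enum_val i) = 0.
  under eq_bigr do rewrite uE scaler_sumr.
  rewrite exchange_big big1 //= => k _.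
  under eq_bigr do rewrite scalerA.
  rewrite -scaler_suml.
  have /matrixP/(_ 0 k) := wA; rewrite !mxE => wk.
  rewrite (_ : \sum_i _ = 0) ?scale0r // -[RHS]wk.
  by apply: eq_bigr => i _; rewrite mxE.
apply/rowP => i; rewrite mxE.
have : ip (\sum_i w 0 i *: u (enum_val i)) (u (enum_val i)) = 0.
  by rewrite comb linear0l.
rewrite linear_sumlz (bigD1 i) //= big1 => [|j ji].
  by rewrite ipZl u_orth eqxx mulr1 addr0.
by rewrite ipZl u_orth (inj_eq enum_val_inj) (negPf ji) mulr0.
Qed.

Variables (I : choiceType) (b : I -> H) (lam : I -> R) (D : unbounded_op H).
Hypothesis b_orth : forall s t, ip (b s) (b t) = (s == t)%:R.
Hypothesis b_complete : forall x, (forall t, ip x (b t) = 0) -> x = 0.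
Hypothesis D_sa : self_adjoint ip D.
Hypothesis D_diag : forall t, D (b t) ((lam t)%:C *: b t).

Lemma b_norm t : hnorm ip (b t) = 1.
Proof. by apply: hnorm_eq1; rewrite b_orth eqxx. Qed.

Lemma coef_ext x y : (forall t, ip x (b t) = ip y (b t)) -> x = y.
Proof.
by move=> xy; apply/eqP; rewrite -subr_eq0; apply/eqP/b_complete => t;
  rewrite ipBl xy subrr.
Qed.

Lemma coef_D x y t : D x y -> ip y (b t) = (lam t)%:C * ip x (b t).
Proof.
case: D_sa => _ DE /DE/(_ _ _ (D_diag t)) Dxy.
by rewrite ipC -Dxy ipZl rmorphM /= -ipC conj_real.
Qed.

Lemma eigenvector_orth l x t : D x (l%:C *: x) -> lam t != l -> ip x (b t) = 0.
Proof.
move=> /(coef_D t); rewrite ipZl => /eqP; rewrite -subr_eq0 -mulrBl mulf_eq0.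
case/orP=> [|/eqP //]; rewrite subr_eq0 => /eqP/complexI->.
by rewrite eqxx.
Qed.

(** The matrix entries of [D, T] are those of [T] multiplied by differences of
    eigenvalues. *)
Lemma commutator_coef T : linear T -> bounded_commutator ip D T ->
  exists c : R, forall s t,
    `|(lam t - lam s)%:C * ip (T (b s)) (b t)| <= c%:C.
Proof.
move=> linT [domT [c cT]]; exists c => s t.
have [z Dz] : domain D (T (b s)) by apply: domT; exists ((lam s)%:C *: b s).
have := cT _ _ _ (D_diag s) Dz; rewrite b_norm mulr1 -lecR => zc.
have := norm_ip_le (z - T ((lam s)%:C *: b s)) (b_norm t).
move/le_trans/(_ zc); congr (`|_| <= _); rewrite ipBl (coef_D t Dz).
by rewrite linear_scale // ipZl -mulrBl rmorphB.
Qed.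

(** Were the set infinite, the resolvent would send a bounded sequence to an
    infinite orthonormal one. *)
Lemma finite_small_eigenvalues K : compact_resolvent ip D ->
  finite_set [set t | `|lam t| <= K].
Proof.
move=> [l [G [[_ cG] GE]]]; apply: contrapT => /infiniteP/card_leP[f].
pose g n : I := val (f (to_setT n)).
have g_inj : injective g.
  move=> m n /val_inj/(@inj _ _ _ f); rewrite !inE => /(_ Logic.I Logic.I).
  by move/(congr1 val).
have gK n : `|lam (g n)| <= K by have := valP (f (to_setT n)); rewrite inE.
pose u n := ((lam (g n))%:C - l) *: b (g n).
have Gu n : G (u n) = b (g n).
  apply/GE; exists ((lam (g n))%:C *: b (g n)); first exact: D_diag.
  by rewrite /u scalerBl.
have [L L0 lL] := norm_real_ex l.
have [|phi [phi_inc [y]]] := cG u.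
  exists (K + L) => n.
  have [r r0 rE] := norm_real_ex ((lam (g n))%:C - l).
  rewrite (hnormZ _ _ rE) b_norm mulr1 -lecR -rE.
  apply: le_trans (ler_normB _ _) _; rewrite lL rmorphD lerD2r.
  by rewrite normc_def /= expr0n addr0 sqrtr_sqr lecR.
(* Two distinct orthonormal vectors are at distance [sqrt 2], which exceeds the
   bound [1] obtained from two vectors at distance [< 1/2] from the limit. *)
rewrite /hconverges => /cvgrPdist_lt/(_ (1/2)) []; first by lra.
move=> N _ Ny.
have := Ny N (leqnn N); have := Ny N.+1 (leqnSn N).
rewrite /= !sub0r !normrN !ger0_norm ?hnorm_ge0 // !Gu => d1 d2.
have : hnorm ip (b (g (phi N)) - b (g (phi N.+1))) ^+ 2 = 2.
  apply: complexI; rewrite -ip_hnorm dnormB !b_orth !eqxx.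
  have /negPf-> : g (phi N) != g (phi N.+1).
    by rewrite (inj_eq g_inj) neq_ltn phi_inc.
  rewrite conjC0 addr0 subr0; exact: esym (rmorph_nat (real_complex R) 2).
have -> : b (g (phi N)) - b (g (phi N.+1)) =
    (b (g (phi N)) - y) + - (b (g (phi N.+1)) - y) by rewrite opprB addrA subrK.
move=> E2; have := parallelogram_le ip (b (g (phi N)) - y)
  (- (b (g (phi N.+1)) - y)).
rewrite E2 hnorm_opp; have := hnorm_ge0 ip (b (g (phi N)) - y).
by have := hnorm_ge0 ip (b (g (phi N.+1)) - y); nra.
Qed.

(** [sign D] differs from [s] only on the finitely many basis vectors at which
    the eigenvalue does not have sign [s], hence by a finite rank operator. *)
Lemma cofinite_sign_trivial (s : R) : s ^+ 2 = 1 ->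
  finite_set [set t | Num.sg (lam t) != s] -> trivial_sign ip D.
Proof.
move=> s2 /finite_seqP[r0 rE]; pose r := undup r0.
have r_in t : (t \in r) = (Num.sg (lam t) != s).
  rewrite mem_undup; have := congr1 (fun A : set I => A t) rE => /= e.
  by apply/idP/idP; rewrite e.
pose c t : R[i] := (Num.sg (lam t) - s)%:C.
pose F x := \sum_(t <- r) (c t * ip x (b t)) *: b t.
have cF : compact_op ip F by exact: compact_op_finite_rank b_norm.
have Fcoef x t : ip (F x) (b t) = c t * ip x (b t).
  rewrite /F linear_sumlz /=.
  under eq_bigr do rewrite ipZl b_orth.
  case: (boolP (t \in r)) => tr.
    rewrite (bigD1_seq t) ?undup_uniq //= eqxx mulr1 big1 ?addr0 // => i.
    by move=> /negPf->; rewrite mulr0.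
  rewrite big_seq big1 => [|i ir]; last first.
    by case: eqP ir tr => [-> ->//|]; rewrite mulr0.
  by move: tr; rewrite r_in negbK /c => /eqP->; rewrite subrr mul0r.
have bS : bounded_op ip (fun x => s%:C *: x + F x).
  apply: bounded_opD; last by case: cF.
  split; first by move=> a x y; rewrite scalerDr !scalerA mulrC.
  exists 1 => x; rewrite (@hnormZ _ _ ip s%:C x 1) //.
  have : `|s%:C| ^+ 2 = 1 :> R[i].
    by rewrite -normrX realC_sqr s2 normr1.
  by move=> /eqP; rewrite sqrp_eq1 // => /eqP.
have eigS l x : D x (l%:C *: x) -> s%:C *: x + F x = (Num.sg l)%:C *: x.
  move=> Dx; apply: coef_ext => t; rewrite ipDl !ipZl Fcoef -mulrDl.
  case: (eqVneq (lam t) l) => [<-|tl]; last first.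
    by rewrite (eigenvector_orth Dx tl) !mulr0.
  by rewrite /c rmorphB /= addrC subrK.
exists (fun x => s%:C *: x + F x); split; first by split.
have /orP[/eqP s1|/eqP s1] : (s == 1) || (s == -1) by rewrite -sqrf_eq1 s2.
  left; suff -> : (fun x => s%:C *: x + F x - x) = F by [].
  by apply/funext => x; rewrite s1 scale1r addrC addKr.
right; suff -> : (fun x => s%:C *: x + F x + x) = F by [].
by apply/funext => x; rewrite s1 rmorphN scaleN1r addrAC addNr add0r.
Qed.

Section SingularValues.
Variables (w : I -> R) (T : H -> H) (mu : nat -> R).
Hypothesis T_diag : forall t, T (b t) = (w t)%:C *: b t.
Hypothesis T_mu : singular_values ip T mu.

(** A basis vector with diagonal entry [s > 0] lies in the eigenspace of [T^* T]
    for [s ^ 2], whose dimension is the number of times [s] occurs in [mu].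
    Hence at least as many singular values as diagonal entries are [>= r], and
    as [mu] is nonincreasing they come first. *)
Lemma singular_value_ge (F : finType) (g : F -> I) (r : R) : injective g ->
  0 < r -> (forall x, r <= w (g x)) -> (0 < #|F|)%N -> r <= mu #|F|.-1.
Proof.
move=> g_inj r0 gr F0; rewrite leNgt; apply/negP => mu_lt.
case: T_mu => mu0 mu_dec [T' [[T'_lin _] T'E] mult].
have T'b t : T' (b t) = (w t)%:C *: b t.
  apply: coef_ext => s; rewrite ipC -T'E T_diag ipZl rmorphM /= -ipC conj_real.
  by rewrite ipZl !b_orth; case: eqVneq => [->//|]; rewrite !mulr0.
suff : (#|F| <= #|'I_(#|F|.-1)|)%N.
  by rewrite card_ord; case: #|F| F0 => // n _; rewrite ltnn.
apply: (@leq_card_fibres R F 'I_(#|F|.-1) (w \o g) (fun k => mu k)) => x /=.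
have w0 : 0 < w (g x) by exact: lt_le_trans (gr x).
have [m dimE] := mult _ w0.
rewrite card_eq_sym => /card_set_bijP[f [f_fun f_inj _]].
have le_m : (#|[pred y | w (g y) == w (g x)]| <= m)%N.
  rewrite -card_sig.
  apply: (orthonormal_card_le_dim (u := fun y => b (g (val y))) dimE).
    case=> y /= /eqP wy.
    rewrite T_diag (linear_scale _ _ T'_lin) T'b scalerA wy.
    by rewrite -rmorphM.
  by move=> y z; rewrite b_orth (inj_eq g_inj) (inj_eq val_inj).
apply: leq_trans le_m _.
have f_lt (k : 'I_m) : (f k < #|F|.-1)%N.
  rewrite ltnNge; apply/negP => le_fk.
  have /= mu_fk := f_fun k (ltn_ord k).
  by have := lt_le_trans mu_lt (gr x); rewrite -mu_fk ltNge mu_dec.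
pose h k := Ordinal (f_lt k).
have h_inj : injective h.
  move=> k l /(congr1 val)/= fkl; apply/val_inj/f_inj => //.
  - by rewrite inE /=.
  - by rewrite inE /=.
rewrite -[m]card_ord -(card_imset _ h_inj); apply: subset_leq_card.
apply/fintype.subsetP => _ /imsetP[k _ ->]; rewrite inE /=.
by have /= -> := f_fun k (ltn_ord k).
Qed.

End SingularValues.

(** If [#|F|] basis vectors have nonzero eigenvalue of size at most [L], the
    first [#|F|] singular values of [|D| ^ (- p)] are at least [L ^ (- p)]; the
    logarithmic bound on their sum thus limits [#|F|]. *)
Lemma p_summable_count (p : R) : 0 < p -> p_summable ip p D ->
  exists (C : R) (N0 : nat), forall (F : finType) (g : F -> I) (L : R),
    injective g -> (N0 <= #|F|)%N -> 0 < L ->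
    (forall x, 0 < `|lam (g x)| <= L) ->
    #|F|%:R * L `^ (- p) <= C * ln #|F|%:R.
Proof.
move=> p0 [T [[T_lin _] T_eig] [_ [mu T_mu]]].
move=> /eqO_exP[C C0 [N0 _ CN0]].
exists C, (maxn 1 N0) => F g L g_inj; rewrite geq_max.
move=> /andP[F0 /CN0 sumC] L0 gL.
pose w t : R := if lam t == 0 then 0 else `|lam t| `^ (- p).
have T_diag t : T (b t) = (w t)%:C *: b t by exact: T_eig.
have wL x : L `^ (- p) <= w (g x).
  have /andP[g0 gL'] := gL x; rewrite /w -normr_eq0 gt_eqF // !powRN.
  rewrite lef_pV2 ?posrE ?powR_gt0 //.
  exact: (ge0_ler_powR (ltW p0) (ltW g0) (ltW L0) gL').

have mu_ge : L `^ (- p) <= mu #|F|.-1.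
  exact: (singular_value_ge T_diag T_mu g_inj (powR_gt0 _ L0) wL F0).
have [mu0 mu_dec _] := T_mu.
have lnF : 0 <= ln #|F|%:R :> R by rewrite ln_ge0 // ler1n.
move: sumC; rewrite /= (ger0_norm lnF) ger0_norm ?sumr_ge0 //.
apply: le_trans; rewrite mulr_natl -[X in _ *+ X]card_ord -sumr_const.
apply: ler_sum => k _; apply: le_trans mu_ge _; apply: mu_dec.
by rewrite -ltnS prednK.
Qed.

End Diagonal.

(** * Sign changes of a function on the quarter plane *)

Section Lattice.
Variable R : realType.
Implicit Types (f : nat -> nat -> R) (C : R).

Lemma gt0_near (x y : R) : `|y - x| < `|x| -> (0 < y) = (0 < x).
Proof.
rewrite ltr_norml; case: (ltrP 0 x) => x0.
  by rewrite gtr0_norm // => /andP[h _]; apply/idP; lra.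
by rewrite ler0_norm // => /andP[_ h]; apply/negbTE; rewrite -leNgt; lra.
Qed.

(** Only the steps in the second variable; those in the first one are the slow
    steps of the transposed function. *)
Definition slow_steps C f := forall a b,
  `|f a b.+1 - f a b| <= C * Num.sqrt ((a + b).+2%:R / b.+1%:R).

Definition coercive f := forall K : R, exists M : nat, forall a b,
  (M <= a + b)%N -> K < `|f a b|.

Definition small_row f := exists (a B : nat) (c : R), forall b,
  (B <= b)%N -> `|f a b| <= c * Num.sqrt b%:R.

Lemma slow_steps_ge0 C f : slow_steps C f -> 0 <= C.
Proof.
move=> /(_ 0%N 0%N) h; have := le_trans (normr_ge0 _) h.
by rewrite pmulr_lge0 // sqrtr_gt0 divr_gt0.
Qed.

(** For [a <= b + 1] the quotient [(a + b + 2) / (b + 1)] is at most [4], so the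
    step is at most [2 C] and too short to cross [0]. *)
Lemma gt0_step C f M a b : slow_steps C f ->
  (forall a b, (M <= a + b)%N -> 2 * C < `|f a b|) ->
  (M <= a + b)%N -> (a <= b.+1)%N -> (0 < f a b.+1) = (0 < f a b).
Proof.
move=> slow far Mab ab; apply: gt0_near; apply: le_lt_trans (far _ _ Mab).
apply: le_trans (slow a b) _; rewrite mulrC ler_wpM2r ?(slow_steps_ge0 slow) //.
rewrite -[leRHS]ger0_norm // -sqrtr_sqr ler_wsqrtr // ler_pdivrMr //.
by rewrite -natrX -natrM ler_nat; lia.
Qed.

(** The sign that the row [a] has to the right of both the diagonal and [M]. *)
Definition row_sign f (M a : nat) : bool := 0 < f a (maxn a M).

Lemma row_signE C f M a b : slow_steps C f ->
  (forall a b, (M <= a + b)%N -> 2 * C < `|f a b|) ->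
  (maxn a M <= b)%N -> (0 < f a b) = row_sign f M a.
Proof.
move=> slow far /subnKC <-; elim: (b - _)%N => [|k IHk]; first by rewrite addn0.
by rewrite addnS (gt0_step slow far) ?IHk //; lia.
Qed.

(** Walk along the staircase [(a, a)], [(a, a+1)], [(a+1, a+1)], ... on which
    both kinds of steps are short. *)
Lemma row_sign_diagonal C f M a : slow_steps C f ->
  slow_steps C (fun a b => f b a) ->
  (forall a b, (M <= a + b)%N -> 2 * C < `|f a b|) ->
  (M <= a)%N -> row_sign f M a = row_sign f M M.
Proof.
move=> slow slow' far /subnKC <-.
elim: (a - M)%N => [|k IHk]; first by rewrite addn0.
have mx j : maxn (M + j) M = (M + j)%N by apply/maxn_idPl/leq_addr.
rewrite -IHk /row_sign !mx addnS.
have far' b c : (M <= b + c)%N -> 2 * C < `|f c b| by rewrite addnC; exact: far.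
by rewrite (gt0_step slow' far') ?(gt0_step slow far) //; lia.
Qed.

(** If the eventual signs of the rows are not all equal, two adjacent rows have
    opposite ones; the value at either row is then at most the step between
    them. *)
Lemma row_sign_const C f M : slow_steps C f ->
  slow_steps C (fun a b => f b a) ->
  (forall a b, (M <= a + b)%N -> 2 * C < `|f a b|) ->
  (forall a, row_sign f M a = row_sign f M M) \/ small_row f.
Proof.
move=> slow slow' far.
have C0 := slow_steps_ge0 slow.
have [/forallP eq_next|] :=
  boolP [forall a : 'I_M, row_sign f M a == row_sign f M a.+1].
  left=> a; have [aM|Ma] := ltnP a M; last first.
    exact: row_sign_diagonal slow slow' far Ma.
  rewrite -{3}(subnK (ltnW aM)) addnC.
  have : (a + (M - a) <= M)%N by lia.
  elim: (M - a)%N => [|k IHk]; first by rewrite addn0.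
  rewrite addnS => lt_ak; have /= /eqP <- := eq_next (Ordinal lt_ak).
  by rewrite IHk // ltnW.
rewrite negb_forall => /existsP[a neq_sign]; right.
exists a, (maxn a.+2 M), (2 * C) => b; rewrite geq_max => /andP[ab Mb].
have /eqP neq_ab : (0 < f a b) != (0 < f a.+1 b).
  by rewrite !(row_signE slow far) // geq_max Mb andbT; lia.
have le_diff : `|f a b| <= `|f a.+1 b - f a b|.
  case: (ltrP 0 (f a b)) (ltrP 0 (f a.+1 b)) neq_ab => [p|n] [p'|n'] // _.
    by rewrite gtr0_norm // ler0_norm; lra.
  by rewrite ler0_norm // ger0_norm; lra.
apply: le_trans le_diff _; apply: le_trans (slow' b a) _.
rewrite [2 * C]mulrC -mulrA ler_wpM2l //.
have -> : 2 * Num.sqrt b%:R = Num.sqrt (2 ^+ 2 * b%:R) :> R.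
  by rewrite sqrtrM ?exprn_ge0 // sqrtr_sqr ger0_norm.
rewrite ler_wsqrtr // ler_pdivrMr // -natrX -!natrM ler_nat; nia.
Qed.

Lemma sign_change_small_row C f : slow_steps C f ->
  slow_steps C (fun a b => f b a) -> coercive f ->
  [\/ exists (s : bool) M, forall a b, (M <= a + b)%N -> (0 < f a b) = s,
      small_row f | small_row (fun a b => f b a)].
Proof.
move=> slow slow' /(_ (2 * C))[M far].
have far' a b : (M <= a + b)%N -> 2 * C < `|f b a| by rewrite addnC; exact: far.
have [row_const|] := row_sign_const slow slow' far; last by constructor 2.
have [col_const|] := row_sign_const slow' slow far'; last by constructor 3.
constructor 1; exists (row_sign f M M), (M + M)%N => a b Mab.
have [ab|ba] := leqP a b.
  by rewrite (row_signE slow far) ?row_const //; lia.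
rewrite -[LHS]/(0 < (fun a b => f b a) b a) (row_signE slow' far').
  by rewrite col_const /row_sign maxnn.
by lia.
Qed.

End Lattice.

(** * A power of M outgrows its logarithm *)

(** The right-hand side is a constant times [M ^ d] with [d = 2 - p / 2 > 0].
    In terms of [y = ln M] this is [exp (d y) >= (1 + d y / 2) ^ 2], quadratic
    in [y], against a left-hand side linear in [y]. *)
Lemma powR_beats_ln (R : realType) (p c C : R) (N0 : nat) :
  0 < p < 4 -> 0 < c ->
  exists2 M : nat, (N0 < M)%N &
    C * ln (M * M)%:R < (M * M)%:R * (c * Num.sqrt M%:R) `^ (- p).
Proof.
move=> /andP[p0 p4] c0; pose d := 2 - p / 2.
have d0 : 0 < d by rewrite /d; lra.
pose q := c `^ (- p); have q0 : 0 < q by exact: powR_gt0.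
pose Y := Num.max 1 (2 * C / (q * (d / 2) ^+ 2)).
pose M := maxn N0 (Num.truncn (expR Y)).
exists M.+1; first by rewrite ltnS leq_maxl.
have M0 : 0 < M.+1%:R :> R by rewrite ltr0n.
pose y := ln M.+1%:R : R.
have yY : Y < y.
  rewrite -[Y]expRK ltr_ln ?posrE ?expR_gt0 //.
  apply: lt_le_trans (truncnS_gt _) _.
  by rewrite ler_nat ltnS leq_maxr.
have y1 : 1 < y by apply: le_lt_trans yY; rewrite le_max lexx.
have yC : 2 * C < q * (d / 2) ^+ 2 * y.
  rewrite [ltRHS]mulrC -ltr_pdivrMr ?mulr_gt0 ?exprn_gt0 ?divr_gt0 //.
  by apply: le_lt_trans yY; rewrite le_max lexx orbT.
have -> : (M.+1 * M.+1)%:R * (c * Num.sqrt M.+1%:R) `^ (- p) =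
    q * expR (d * y).
  rewrite powRM ?ltW ?sqrtr_ge0 // -/q -powR12_sqrt ?ltW // -powRrM natrM.
  rewrite /powR gt_eqF // -/y mulrCA; congr (_ * _).
  by rewrite -[M.+1%:R]lnK ?posrE // -/y -!expRD; congr expR; rewrite /d; field.
rewrite natrM lnM ?posrE // -/y.
have exp_ge : (1 + d / 2 * y) ^+ 2 <= expR (d * y).
  have -> : d * y = d / 2 * y + d / 2 * y by field.
  rewrite expRD -expr2 lerXn2r ?nnegrE ?expR_ge0 ?expR_ge1Dx //.
  by rewrite addr_ge0 // mulr_ge0 ?divr_ge0 ?ltW //; lra.
apply: lt_le_trans (_ : q * (d / 2 * y) ^+ 2 <= _).
  have : 0 < (q * (d / 2) ^+ 2 * y - 2 * C) * y.
    by rewrite mulr_gt0 ?subr_gt0 //; lra.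
  lra.
rewrite ler_pM2l //; apply: le_trans exp_ge.
by rewrite lerXn2r ?nnegrE ?lerDr ?addr_ge0 ?mulr_ge0 ?divr_ge0 ?ltW //; lra.
Qed.

(** * Spectral triples on SU(2) *)

Section SU2Basis.
Variables (R : realType) (H : lmodType R[i]).
Variable ip : {dot H for (@Num.conj R[i])}.
Variable e : R -> R -> R -> H.
Hypothesis e_basis : orthonormal_basis ip e.

(** The triple [(a, b, v)] stands for [(n, i, j)] with [a = n - i], [b = n + i]
    and [v = n + j], so that [2 n = a + b]. *)
Definition su2_index : Type := {t : nat * nat * nat | (t.2 <= t.1.1 + t.1.2)%N}.

Definition coord_n (a b : nat) : R := (a + b)%:R / 2.
Definition coord_i (a b : nat) : R := (b%:R - a%:R) / 2.
Definition coord_j (a b v : nat) : R := v%:R - (a + b)%:R / 2.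

Definition basis (t : su2_index) : H :=
  let: (a, b, v) := val t in e (coord_n a b) (coord_i a b) (coord_j a b v).

Definition mk_index (a b v : nat) (le_v : (v <= a + b)%N) : su2_index :=
  exist (fun t : nat * nat * nat => (t.2 <= t.1.1 + t.1.2)%N) (a, b, v) le_v.

Lemma in_range_coord a b v : (v <= a + b)%N ->
  in_range (coord_n a b) (coord_i a b) (coord_j a b v).
Proof.
move=> le_v; rewrite /in_range /coord_n /coord_i /coord_j.
apply/and5P; split; apply/natrP.
- by exists (a + b)%N; rewrite mulrC divfK ?pnatr_eq0.
- by exists b; rewrite natrD; field.
- by exists a; rewrite natrD; field.
- by exists v; rewrite addrC subrK.
- by exists (a + b - v)%N; rewrite natrB //; field.
Qed.

Lemma in_range_ex n i j : in_range n i j -> exists a b v, [/\ (v <= a + b)%N,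
  n = coord_n a b, i = coord_i a b & j = coord_j a b v].
Proof.
case/and5P=> _ /natrP[b nb] /natrP[a na] /natrP[v nv] /natrP[v' nv'].
have vv' : (v + v')%N = (a + b)%N.
  by apply/eqP; rewrite -(eqr_nat R) !natrD -nv -nv' -na -nb; apply/eqP; ring.
exists a, b, v; split; first by rewrite -vv' leq_addr.
- by rewrite /coord_n natrD -na -nb; field.
- by rewrite /coord_i -na -nb; field.
- by rewrite /coord_j natrD -nv -na -nb; field.
Qed.

Lemma coord_inj a b v a' b' v' :
  (coord_n a b, coord_i a b, coord_j a b v) =
    (coord_n a' b', coord_i a' b', coord_j a' b' v') ->
  (a, b, v) = (a', b', v').
Proof.
rewrite /coord_n /coord_i /coord_j !natrD => -[En Ei Ej].
congr (_, _, _); apply/eqP; rewrite -(eqr_nat R); apply/eqP; lra.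
Qed.

Lemma basis_orth s t : ip (basis s) (basis t) = (s == t)%:R.
Proof.
case: s t => [[[a b] v] /= le_v] [[[a' b'] v'] /= le_v']; rewrite /basis /=.
case: e_basis => orth _ _; rewrite orth ?in_range_coord //.
congr (nat_of_bool _)%:R; rewrite -val_eqE /=.
by apply/eqP/eqP => [/coord_inj|[-> -> ->]].
Qed.

Lemma basis_complete x : (forall t, ip x (basis t) = 0) -> x = 0.
Proof.
case: e_basis => _ _ complete x0; apply: complete => n i j.
by move=> /in_range_ex[a [b [v [le_v -> -> ->]]]]; exact: (x0 (mk_index le_v)).
Qed.

Lemma ip_e_neq n i j n' i' j' : n != n' -> ip (e n i j) (e n' i' j') = 0.
Proof.
move=> nn'; case: e_basis => orth out _.
have [r|/out->] := boolP (in_range n i j); last by rewrite linear0l.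
have [r'|/out->] := boolP (in_range n' i' j'); last by rewrite linear0r.
by rewrite orth // xpair_eqE xpair_eqE (negPf nn').
Qed.

Lemma finite_index M :
  finite_set [set t : su2_index | ((val t).1.1 + (val t).1.2 < M)%N].
Proof.
apply: (@sub_finite_set _ _ (val @^-1` ((`I_M `*` `I_M) `*` `I_M))).
  by case=> [[[a b] v] /= le_v] ab; do !split => /=; lia.
apply: finite_preimage; last by do !apply: finite_setX; exact: finite_II.
by move=> s t _ _; exact: val_inj.
Qed.

(** At [j = - n], that is [v = 0], the factor [2 n + 1] of the coefficient
    cancels. *)
Lemma a_plus_lowest a b :
  a_plus (coord_n a b) (coord_i a b) (coord_j a b 0) =
    Num.sqrt (a.+1%:R / (a + b).+2%:R).
Proof.
have a0 : 0 <= a%:R :> R by []; have b0 : 0 <= b%:R :> R by [].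
rewrite /a_plus /coord_n /coord_i /coord_j; congr Num.sqrt.
by rewrite -!natr1 natrD; field; rewrite !gt_eqF; lra.
Qed.

Lemma b_plus_lowest a b :
  b_plus (coord_n a b) (coord_i a b) (coord_j a b 0) =
    - Num.sqrt (b.+1%:R / (a + b).+2%:R).
Proof.
have a0 : 0 <= a%:R :> R by []; have b0 : 0 <= b%:R :> R by [].
rewrite /b_plus /coord_n /coord_i /coord_j; congr (- Num.sqrt _).
by rewrite -!natr1 natrD; field; rewrite !gt_eqF; lra.
Qed.

Variables (alpha beta : H -> H).
Hypothesis e_alpha : is_alpha ip e alpha.
Hypothesis e_beta : is_beta ip e beta.

(** [alpha] raises [a] and [beta] raises [b], both keeping [v]; the other term
    of each formula lowers [n] and is orthogonal. *)
Lemma alpha_coef a b :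
  ip (alpha (basis (mk_index (leq0n (a + b)))))
     (basis (mk_index (leq0n (a.+1 + b)))) =
  (Num.sqrt (a.+1%:R / (a + b).+2%:R))%:C.
Proof.
case: e_alpha => _; rewrite /basis /= => ->; last exact: in_range_coord.
have -> : coord_n a b + 1 / 2 = coord_n a.+1 b.
  by rewrite /coord_n addSn -addn1 natrD; field.
have -> : coord_i a b - 1 / 2 = coord_i a.+1 b.
  by rewrite /coord_i -addn1 natrD; field.
have -> : coord_j a b 0 - 1 / 2 = coord_j a.+1 b 0.
  by rewrite /coord_j addSn -addn1 natrD; field.
rewrite ipDl !ipZl [X in _ + _ * X]ip_e_neq ?mulr0 ?addr0; last first.
  by rewrite /coord_n addSn -[(a + b).+1%:R]natr1; apply/eqP => E; lra.
rewrite a_plus_lowest.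
have /= -> := basis_orth (mk_index (leq0n (a.+1 + b)))
  (mk_index (leq0n (a.+1 + b))).
by rewrite eqxx mulr1.
Qed.

Lemma beta_coef a b :
  ip (beta (basis (mk_index (leq0n (a + b)))))
     (basis (mk_index (leq0n (a + b.+1)))) =
  (- Num.sqrt (b.+1%:R / (a + b).+2%:R))%:C.
Proof.
case: e_beta => _; rewrite /basis /= => ->; last exact: in_range_coord.
have -> : coord_n a b + 1 / 2 = coord_n a b.+1.
  by rewrite /coord_n addnS -addn1 natrD; field.
have -> : coord_i a b + 1 / 2 = coord_i a b.+1.
  by rewrite /coord_i -[b.+1]addn1 natrD; field.
have -> : coord_j a b 0 - 1 / 2 = coord_j a b.+1 0.
  by rewrite /coord_j addnS -addn1 natrD; field.
rewrite ipDl !ipZl [X in _ + _ * X]ip_e_neq ?mulr0 ?addr0; last first.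
  by rewrite /coord_n addnS -[(a + b).+1%:R]natr1; apply/eqP => E; lra.
rewrite b_plus_lowest.
have /= -> := basis_orth (mk_index (leq0n (a + b.+1)))
  (mk_index (leq0n (a + b.+1))).
by rewrite eqxx mulr1.
Qed.

Variables (D : unbounded_op H) (d : R -> R -> R).
Hypothesis D_triple : spectral_triple ip alpha beta D.
Hypothesis D_diag : forall n i j, in_range n i j ->
  D (e n i j) ((d n i)%:C *: e n i j).

Definition eigenvalue (a b : nat) : R := d (coord_n a b) (coord_i a b).
Let lam (t : su2_index) := eigenvalue (val t).1.1 (val t).1.2.

Lemma D_basis t : D (basis t) ((lam t)%:C *: basis t).
Proof. by case: t => [[[a b] v] /= le_v]; apply/D_diag/in_range_coord. Qed.

Let D_sa : self_adjoint ip D. Proof. by case: D_triple. Qed.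

Lemma step_bound (x y c : R) (k m : nat) :
  `|((x - y) * Num.sqrt (k.+1%:R / m.+1%:R))%:C| <= (c%:C : R[i]) ->
  `|x - y| <= c * Num.sqrt (m.+1%:R / k.+1%:R).
Proof.
rewrite normc_def /= expr0n addr0 sqrtr_sqr lecR normrM.
have q0 : 0 < Num.sqrt (m.+1%:R / k.+1%:R) :> R by rewrite sqrtr_gt0 divr_gt0.
rewrite [`|Num.sqrt _|]ger0_norm ?sqrtr_ge0 // -ler_pdivrMr //.
congr (_ <= _); congr (_ * _); rewrite -sqrtrV ?divr_ge0 //.
by rewrite invf_div.
Qed.

(** Among the entries of [alpha] and [beta] that raise [n], those at [v = 0] are
    largest; the commutator bound divided by them is the bound on the steps. *)
Lemma eigenvalue_slow : exists C,
  slow_steps C eigenvalue /\ slow_steps C (fun a b => eigenvalue b a).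
Proof.
have [_ _ bd] := D_triple.
have [ca ca_le] := commutator_coef basis_orth D_sa D_basis
  (let: conj (conj l _) _ := e_alpha in l) (bd _ (star_genl _ _ _)).
have [cb cb_le] := commutator_coef basis_orth D_sa D_basis
  (let: conj (conj l _) _ := e_beta in l) (bd _ (star_genr _ _ _)).
exists (Num.max ca cb); split=> a b.
  apply: le_trans (_ : cb * Num.sqrt ((a + b).+2%:R / b.+1%:R) <= _).
    apply: step_bound.
    have := cb_le (mk_index (leq0n (a + b))) (mk_index (leq0n (a + b.+1))).
    by rewrite beta_coef -rmorphM mulrN rmorphN normrN.
  by rewrite ler_wpM2r ?sqrtr_ge0 // le_max lexx orbT.
apply: le_trans (_ : ca * Num.sqrt ((a + b).+2%:R / b.+1%:R) <= _).
  apply: step_bound.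
  have := ca_le (mk_index (leq0n (b + a))) (mk_index (leq0n (b.+1 + a))).
  by rewrite alpha_coef -rmorphM [(b + a)%N]addnC.
by rewrite ler_wpM2r ?sqrtr_ge0 // le_max lexx.
Qed.

Lemma eigenvalue_coercive : coercive eigenvalue.
Proof.
move=> K; have [_ cr _] := D_triple.
have /finite_seqP[r rE] := finite_small_eigenvalues basis_orth D_basis K cr.
exists (\max_(t <- r) ((val t).1.1 + (val t).1.2)).+1 => a b Mab.
rewrite ltNge; apply/negP => small.
have : mk_index (leq0n (a + b)) \in r.
  have := congr1 (fun A : set su2_index => A (mk_index (leq0n (a + b)))) rE.
  by move=> /= <-.
move=> in_r; move: Mab; rewrite ltnNge => /negP; apply.
exact: (leq_bigmax_seq (P := xpredT)
  (F := fun t : su2_index => ((val t).1.1 + (val t).1.2)%N) _ in_r).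
Qed.

Lemma eventual_sign_trivial (s : bool) M :
  (forall a b, (M <= a + b)%N -> (0 < eigenvalue a b) = s) -> trivial_sign ip D.
Proof.
move=> sM; have [M' M'0] := eigenvalue_coercive 0.
have sq : (if s then 1 else -1 : R) ^+ 2 = 1.
  by case: (s); rewrite ?sqrrN expr1n.
apply: (cofinite_sign_trivial basis_orth basis_complete D_sa D_basis sq).
apply: sub_finite_set (finite_index (maxn M M')) => t /=; apply: contraNltn.
rewrite geq_max => /andP[/sM lam_s /M'0]; rewrite normr_gt0 => lam0.
rewrite /lam; case: s lam_s {sM sq} => lam_s; first by rewrite gtr0_sg.
by rewrite ltr0_sg // lt_neqAle lam0 leNgt lam_s.
Qed.

(** The heights [M <= u < 2 M], each with the vectors [v < M], provide [M ^ 2]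
    eigenvectors with eigenvalue at most [c sqrt (2 M)]: too many for
    summability, as [powR_beats_ln] shows. *)
Lemma small_line_not_summable p (l : nat -> nat * nat) B c : 0 < p < 4 ->
  injective l -> (forall u, (u <= (l u).1 + (l u).2)%N) ->
  (forall u, (B <= u)%N ->
    `|eigenvalue (l u).1 (l u).2| <= c * Num.sqrt u%:R) ->
  ~ p_summable ip p D.
Proof.
move=> p04 l_inj l_ge l_small; have /andP[p0 p4] := p04.
move/(p_summable_count basis_orth basis_complete D_basis p0) => [C [N0 count]].
have [M0 M0_gt0] := eigenvalue_coercive 0.
(* [sqrt (2 M) <= 2 sqrt M]; the maximum keeps the constant positive. *)
pose c' := 2 * Num.max 1 c.
have c'0 : 0 < c' by rewrite mulr_gt0 // lt_max ltr01.
have [M] := @powR_beats_ln R p c' C (maxn N0 (maxn M0 B)) p04 c'0.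
rewrite !gtn_max => /and3P[N0M M0M BM]; rewrite ltNge => /negP; apply.
have le_index (x : 'I_M * 'I_M) :
    (x.2 <= (l (M + x.1)%N).1 + (l (M + x.1)%N).2)%N.
  by apply: leq_trans (l_ge _); case: x => u v /=; have := ltn_ord v; lia.
pose g x := mk_index (le_index x).
have g_inj : injective g.
  move=> [u v] [u' v'] /(congr1 val)/= [l1 l2 vv'].
  have /l_inj/addnI uu' : l (M + u)%N = l (M + u')%N.
    by rewrite [LHS]surjective_pairing l1 l2 -surjective_pairing.
  by congr (_, _); exact: val_inj.
have card_MM : #|{: 'I_M * 'I_M}| = (M * M)%N by rewrite card_prod !card_ord.
rewrite -card_MM; apply: (count _ g) => //.
- by rewrite card_MM; nia.
- by rewrite mulr_gt0 // sqrtr_gt0 ltr0n; lia.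
move=> [u v]; rewrite /lam /= M0_gt0 /=; last by apply: leq_trans (l_ge _); lia.
apply: le_trans (l_small _ _) _; first by lia.
rewrite /c' [2 * _]mulrC -mulrA.
apply: le_trans (_ : Num.max 1 c * Num.sqrt (M + u)%:R <= _).
  by rewrite ler_wpM2r ?sqrtr_ge0 // le_max lexx orbT.
rewrite ler_wpM2l //; first by rewrite le_max ler01.
have -> : 2 * Num.sqrt M%:R = Num.sqrt (2 ^+ 2 * M%:R) :> R.
  by rewrite sqrtrM ?exprn_ge0 // sqrtr_sqr ger0_norm.
rewrite ler_wsqrtr // -natrX -natrM ler_nat; have := ltn_ord u; lia.
Qed.

End SU2Basis.

Theorem theorem5p4 (R : realType) (H : lmodType R[i])
    (ip : {dot H for (@Num.conj R[i])})
    (e : R -> R -> R -> H) (alpha beta : H -> H) (D : unbounded_op H) (p : R) :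
  hilbert ip ->
  orthonormal_basis ip e ->
  is_alpha ip e alpha ->
  is_beta ip e beta ->
  spectral_triple ip alpha beta D ->
  equivariant e D ->
  ~ trivial_sign ip D ->
  0 < p -> p < 4 ->
  ~ p_summable ip p D.
Proof.
move=> _ e_basis e_alpha e_beta triple [d D_diag] nontrivial p0 p4.
have p04 : 0 < p < 4 by rewrite p0.
have [C [slow slow']] := eigenvalue_slow e_basis e_alpha e_beta triple D_diag.
have far := eigenvalue_coercive e_basis triple D_diag.
have [[s [M sM]]|[a [B [c small]]]|[b [B [c small]]]] :=
  sign_change_small_row slow slow' far.
- by case: nontrivial; exact: (eventual_sign_trivial e_basis triple D_diag sM).
- apply: (small_line_not_summable e_basis triple D_diag
    (l := fun u => (a, u)) p04 _ _ small).
  + by move=> u v [].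
  + by move=> u; exact: leq_addl.
- apply: (small_line_not_summable e_basis triple D_diag
    (l := fun u => (u, b)) p04 _ _ small).
  + by move=> u v [].
  + by move=> u; exact: leq_addr.
Qed.
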